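(* For all constants $\gamma>0$ and $c>0$ there exist constants $K$ and $n_0$ such that the following holds for all integers $n\ge n_0$, all integers $\ell\in\{1,\dots,n\}$ with $\gamma\le\frac{\ell}{n}\le 1-\gamma$, and all integers $m\ge c\,n^3$. Let $q=\ell\cdot\frac mn$, let $w_1\le\dots\le w_n$ be the weights generated by the uniform balls and bins process with $m$ balls and $n$ bins, and let $\varphi_1$ be the Shapley value of agent $1$ (the agent of minimal weight) in the weighted voting game with these weights and quota $q$. Then $$\mathbb{E}[\varphi_1]\ \ge\ \frac1n-K\sqrt{\frac{\log n}{n^3}},$$ where the expectation is over the generation of the weights.
   Context: Uniform balls and bins process: each of $m$ balls is thrown independently into one of $n$ bins, each bin having probability $1/n$; the weights $w_1\le\dots\le w_n$ are the resulting bin loads sorted in non-decreasing order. Weighted voting game with agents $N=\{1,\dots,n\}$, weights $w_i$ and quota $q$: for $S\subseteq N$ let $w(S)=\sum_{i\in S}w_i$; $v(S)=1$ if $w(S)\ge q$, and $v(S)=0$ otherwise. Shapley value: $\varphi_i=\frac1{n!}\sum_{\sigma}\left(v(P_i(\sigma)\cup\{i\})-v(P_i(\sigma))\right)$, the sum over all permutations $\sigma$ of $N$, where $P_i(\sigma)=\{j\in N:\sigma(j)<\sigma(i)\}$. *)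

(* Defs.v *)
From HB Require Import structures.
From mathcomp Require Import all_boot all_order all_algebra all_fingroup.
From mathcomp Require Import all_classical all_reals all_analysis.

Set Implicit Arguments.
Unset Strict Implicit.
Unset Printing Implicit Defensive.

Import Order.TTheory GRing.Theory Num.Theory.

Local Open Scope ring_scope.

Section WeightedVoting.
Variables (R : realType) (n : nat).

Definition coalition_weight (w : 'I_n -> R) (S : {set 'I_n}) : R :=
  \sum_(i in S) w i.

Definition voting_game (w : 'I_n -> R) (q : R) (S : {set 'I_n}) : R :=
  if q <= coalition_weight w S then 1 else 0.

(* s j is the position of agent j in the ordering. *)
Definition predecessors (s : {perm 'I_n}) (i : 'I_n) : {set 'I_n} :=
  [set j : 'I_n | (s j < s i)%N].

Definition shapley (v : {set 'I_n} -> R) (i : 'I_n) : R :=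
  (n`!%:R)^-1 *
  \sum_(s : {perm 'I_n}) (v (predecessors s i :|: [set i]) - v (predecessors s i)).

End WeightedVoting.

Section BallsAndBins.
Variables (m n : nat).

(* An outcome sends each of the m balls to one of the n bins. *)
Definition outcome := {ffun 'I_m -> 'I_n}.

Definition bin_load (f : outcome) (j : 'I_n) : nat := #|[set b | f b == j]|.

Definition sorted_loads (f : outcome) : seq nat :=
  sort leq [seq bin_load f j | j <- enum 'I_n].

(* Agents are indexed from 0: agent i of the paper is the ordinal i - 1. *)
Definition bb_weight (R : realType) (f : outcome) (i : 'I_n) : R :=
  (nth 0%N (sorted_loads f) i)%:R.

(* Independent balls, each landing in a given bin with probability 1/n. *)
Definition outcome_prob (R : realType) (f : outcome) : R :=
  \prod_(b < m) (n%:R)^-1.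

Definition bb_expectation (R : realType) (X : outcome -> R) : R :=
  \sum_(f : outcome) outcome_prob R f * X f.

End BallsAndBins.

(* Main.v *)
(** Give agent 1 position [l] or [l + 1] of a random ordering and exchange the
    agents in these two positions: agent 1 is pivotal in at least one of the two
    orderings unless the weight [w(T)] of the first [l] agents (agent 1 among
    them) is far from [q] or lies in a window below [q] of the width of the
    spread of the weights.  This exceptional event depends on [T] only, so the
    condition [1 \in T] can be dropped at the cost of a factor [n / l]; then [T]
    is a uniform [l]-set, the sorting of the loads no longer matters, and [w(T)]
    is binomial with parameters [m] and [l / n].  Chernoff bounds make the spread
    of the loads [O(sqrt (m / n * ln n))] and rule out large deviations of
    [w(T)], while the binomial probabilities are [O(1 / sqrt m)], so the window
    has probability [O(sqrt (ln n / n))]. *)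

Require Import Defs.
From mathcomp Require Import all_boot all_order all_algebra all_fingroup.
From mathcomp Require Import all_classical all_reals all_analysis.
From mathcomp Require Import ring lra.

Set Implicit Arguments.
Unset Strict Implicit.
Unset Printing Implicit Defensive.

Import Order.TTheory GRing.Theory Num.Theory.
Local Open Scope ring_scope.

(** * Expectations and probabilities in the balls and bins process *)

Definition hits (m n : nat) (f : outcome m n) (T : {set 'I_n}) : nat :=
  #|[set b | f b \in T]|.

Definition bb_prob (R : realType) (m n : nat) (P : pred (outcome m n)) : R :=
  bb_expectation (fun f => (P f)%:R).

Lemma sum_bin_load (m n : nat) (f : outcome m n) (T : {set 'I_n}) :
  (\sum_(j in T) bin_load f j)%N = hits f T.
Proof.
rewrite /hits -sum1_card (partition_big f (mem T)) /=; last by move=> b; rewrite inE.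
apply: eq_bigr => j jT; rewrite /bin_load -sum1_card; apply: eq_bigl => b.
by rewrite !inE; case: eqP => [->|]; rewrite ?jT ?andbF.
Qed.

Lemma hits_set1 (m n : nat) (f : outcome m n) (j : 'I_n) :
  hits f [set j] = bin_load f j.
Proof. by rewrite -sum_bin_load big_set1. Qed.

Lemma sum_outcome_prod (A : comNzRingType) (m n : nat) (g : 'I_n -> A) :
  \sum_(f : outcome m n) \prod_(b < m) g (f b) = (\sum_j g j) ^+ m.
Proof.
rewrite -(bigA_distr_bigA (fun (_ : 'I_m) j => g j)).
by rewrite prodr_const card_ord.
Qed.

Lemma outcome_prob_ge0 (R : realType) (m n : nat) (f : outcome m n) :
  0 <= outcome_prob R f.
Proof. by apply: prodr_ge0 => b _; rewrite invr_ge0. Qed.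

Lemma bb_expectation_prod (R : realType) (m n : nat) (g : 'I_n -> R) :
  bb_expectation (fun f : outcome m n => \prod_(b < m) g (f b)) =
  (n%:R^-1 * \sum_j g j) ^+ m.
Proof.
rewrite mulr_sumr -sum_outcome_prod; apply: eq_bigr => f _.
by rewrite -big_split.
Qed.

Lemma le_bb_expectation (R : realType) (m n : nat) (X Y : outcome m n -> R) :
  (forall f, X f <= Y f) -> bb_expectation X <= bb_expectation Y.
Proof.
move=> XY; apply: ler_sum => f _.
by apply: ler_wpM2l => //; apply: outcome_prob_ge0.
Qed.

Lemma bb_expectation_sum (R : realType) (m n : nat) (I : finType)
    (X : I -> outcome m n -> R) :
  bb_expectation (fun f => \sum_i X i f) = \sum_i bb_expectation (X i).
Proof.
rewrite /bb_expectation exchange_big /=.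
by apply: eq_bigr => f _; rewrite mulr_sumr.
Qed.

Lemma bb_expectationD (R : realType) (m n : nat) (X Y : outcome m n -> R) :
  bb_expectation (fun f => X f + Y f) = bb_expectation X + bb_expectation Y.
Proof.
by rewrite /bb_expectation -big_split; apply: eq_bigr => f _; rewrite mulrDr.
Qed.

Lemma bb_expectationZ (R : realType) (m n : nat) (a : R) (X : outcome m n -> R) :
  bb_expectation (fun f => a * X f) = a * bb_expectation X.
Proof.
by rewrite /bb_expectation mulr_sumr; apply: eq_bigr => f _; rewrite mulrCA.
Qed.

Lemma bb_expectation_cst (R : realType) (m n : nat) (a : R) :
  (0 < n)%N -> bb_expectation (fun _ : outcome m n => a) = a.
Proof.
move=> n_gt0; rewrite -[a]mulr1 bb_expectationZ.
have -> : bb_expectation (fun _ : outcome m n => 1 : R) = 1; last by [].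
transitivity (bb_expectation (fun f : outcome m n => \prod_(b < m) (1 : R))).
  by apply: eq_bigr => f _; rewrite big1.
rewrite (bb_expectation_prod _ (fun=> 1)) sumr_const card_ord mulVf ?expr1n //.
by rewrite pnatr_eq0 -lt0n.
Qed.

Lemma le_bb_prob (R : realType) (m n : nat) (P Q : pred (outcome m n)) :
  (forall f, P f -> Q f) -> bb_prob R P <= bb_prob R Q.
Proof.
move=> PQ; apply: le_bb_expectation => f; rewrite ler_nat.
by case Pf: (P f) => //; rewrite PQ.
Qed.

Lemma bb_probU (R : realType) (m n : nat) (P Q : pred (outcome m n)) :
  bb_prob R (predU P Q) <= bb_prob R P + bb_prob R Q.
Proof.
rewrite -bb_expectationD; apply: le_bb_expectation => f /=.
by rewrite -natrD ler_nat; case: (P f); case: (Q f).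
Qed.

Lemma bb_prob_exists (R : realType) (m n : nat) (I : finType)
    (P : I -> pred (outcome m n)) :
  bb_prob R (fun f => [exists i, P i f]) <= \sum_i bb_prob R (P i).
Proof.
rewrite -bb_expectation_sum; apply: le_bb_expectation => f.
case: existsP => [[i Pif]|_]; last by apply: sumr_ge0.
by rewrite (bigD1 i) //= Pif lerDl sumr_ge0.
Qed.

(** * Point probabilities of the number of balls in a set of bins *)

Lemma sum_mean_indicator (R : realType) (n : nat) (T : {set 'I_n}) (x : R) :
  (0 < n)%N ->
  n%:R^-1 * \sum_j (if j \in T then x else 1) = 1 + #|T|%:R / n%:R * (x - 1).
Proof.
move=> n_gt0; have n0 : n%:R != 0 :> R by rewrite pnatr_eq0 -lt0n.
have -> : \sum_j (if j \in T then x else 1) = n%:R + #|T|%:R * (x - 1).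
  transitivity (\sum_j (1 + (if j \in T then x - 1 else 0))).
    by apply: eq_bigr => j _; case: ifP => _; rewrite ?addr0 // addrC subrK.
  rewrite big_split /= sumr_const card_ord -big_mkcond /= sumr_const.
  by rewrite mulr_natl.
by field.
Qed.

(** The balls are independent, so the sum over outcomes splits into one factor per ball, in which
    landing in [T] contributes [X] and landing elsewhere contributes 1. This encodes the binomial
    law without binomial coefficients. *)
Lemma hits_generating_poly (R : realType) (m n : nat) (T : {set 'I_n}) :
  (0 < n)%N ->
  \sum_(f : outcome m n) outcome_prob R f *: 'X^(hits f T) =
  (1 + (#|T|%:R / n%:R) *: ('X - 1)) ^+ m :> {poly R}.
Proof.
move=> n_gt0; have n0 : n%:R != 0 :> R by rewrite pnatr_eq0 -lt0n.
transitivity ((\sum_(j < n) n%:R^-1 *: (if j \in T then 'X else 1 : {poly R})) ^+ m).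
  rewrite -sum_outcome_prod; apply: eq_bigr => f _.
  rewrite scaler_prod -big_mkcond /=; congr (_ *: _).
  by rewrite prodr_const /hits cardsE.
congr (_ ^+ m); rewrite -scaler_sumr.
transitivity (n%:R^-1 *: \sum_(j < n) (1 + (if j \in T then 'X - 1 else 0 : {poly R}))).
  by congr (_ *: _); apply: eq_bigr => j _; case: ifP => _; rewrite ?addr0 // addrC subrK.
rewrite big_split /= sumr_const card_ord -big_mkcond /= sumr_const scalerDr.
by rewrite -!(scaler_nat _ (_ : {poly R})) !scalerA mulVf // scale1r mulrC.
Qed.

Lemma hits_prob_coef (R : realType) (m n k : nat) (T : {set 'I_n}) :
  bb_prob R (fun f : outcome m n => hits f T == k) =
  (\sum_(f : outcome m n) outcome_prob R f *: 'X^(hits f T) : {poly R})`_k.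
Proof.
by rewrite coef_sum; apply: eq_bigr => f _; rewrite coefZ coefXn eq_sym.
Qed.

(* Comparing coefficients in [(1 - p + p X) G' = m p G] for the generating
   polynomial [G = (1 - p + p X) ^ m]. *)
Lemma hits_prob_succ (R : realType) (m n k : nat) (T : {set 'I_n}) :
  (0 < n)%N ->
  let p : R := #|T|%:R / n%:R in
  let b i : R := bb_prob R (fun f : outcome m n => hits f T == i) in
  (1 - p) * k.+1%:R * b k.+1 = (m%:R - k%:R) * p * b k.
Proof.
move=> n_gt0 p b.
pose L : {poly R} := 1 + p *: ('X - 1).
have bE i : b i = (L ^+ m)`_i by rewrite /b hits_prob_coef hits_generating_poly.
have LE : L = (1 - p)%:P + p *: 'X.
  rewrite /L scalerBr -!mul_polyC mulr1 polyCB; ring.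
have dL : L^`() = p%:P by rewrite LE !derivCE -mul_polyC mulr1 add0r.
have ode : L * (L ^+ m)^`() = (m%:R * p) *: L ^+ m.
  case: (m) => [|i]; first by rewrite expr0 -polyC1 derivC mulr0 mul0r scale0r.
  by rewrite deriv_exp dL /= mulrnAr mulrCA -exprS mul_polyC -scaler_nat scalerA.
have := congr1 (fun q : {poly R} => q`_k) ode.
rewrite LE mulrDl -LE mul_polyC coefD !coefZ -scalerAl coefZ coefXM !coef_deriv -!bE.
(* The product of [X] with the derivative has no constant term, so [k = 0] is treated apart. *)
case: (k) => [|i] /=; rewrite ?coef_deriv -?bE -!(mulr_natr (b _)) => H.
  by rewrite mulr0 addr0 in H; rewrite subr0 -H; ring.
rewrite !mulrBl -H; ring.
Qed.

(* For [k <= mp] the ratios of consecutive probabilities after [k] are at least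
   [1 - r / (m p (1 - p))], so the next [r] probabilities are at least half of
   the probability of [k]. *)
Lemma hits_prob_le (R : realType) (m n k r : nat) (T : {set 'I_n}) :
  (0 < m)%N -> (0 < n)%N ->
  let p : R := #|T|%:R / n%:R in
  0 < p < 1 -> k%:R <= m%:R * p -> 2 * r%:R ^+ 2 <= m%:R * p * (1 - p) ->
  bb_prob R (fun f : outcome m n => hits f T == k) <= 2 / r.+1%:R.
Proof.
move=> m_gt0 n_gt0 p /andP[p_gt0 p_lt1] kmp rle.
pose b i : R := bb_prob R (fun f : outcome m n => hits f T == i).
have b_ge0 i : 0 <= b i.
  by apply: sumr_ge0 => f _; rewrite mulr_ge0 // outcome_prob_ge0.
have sum_le1 : \sum_(j < r.+1) b (k + j)%N <= 1.
  rewrite /b -bb_expectation_sum -[leRHS](bb_expectation_cst m (1 : R) n_gt0).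
  apply: le_bb_expectation => f /=.
  have [j0 hj0|none] := pickP (fun j : 'I_r.+1 => hits f T == (k + j)%N); last first.
    by rewrite big1 // => j _; rewrite none.
  rewrite (bigD1 j0) //= hj0 big1 ?addr0 // => j jj0.
  rewrite (eqP hj0) eqn_add2l; case: eqP => // /esym/val_inj jE.
  by rewrite jE eqxx in jj0.
have succ i : (1 - p) * i.+1%:R * b i.+1 = (m%:R - i%:R) * p * b i.
  exact: hits_prob_succ.
rewrite -/(b k); clearbody b; clearbody p.
pose v : R := m%:R * p * (1 - p).
have v_gt0 : 0 < v by rewrite mulr_gt0 ?subr_gt0 // mulr_gt0 // ltr0n.
have step i : i.+1%:R <= m%:R * p + r%:R -> (1 - r%:R / v) * b i <= b i.+1.
  move=> ir; have q_gt0 : 0 < 1 - p by rewrite subr_gt0.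
  have c_gt0 : 0 < (1 - p) * i.+1%:R by rewrite mulr_gt0 ?ltr0n.
  rewrite -(ler_pM2l c_gt0) succ mulrA.
  apply: ler_wpM2r => //.
  have rv : r%:R / v * (1 - p) * (m%:R * p) = r%:R.
    rewrite /v; field; rewrite !lt0r_neq0 //; last by rewrite ltr0n.
  have d_ge0 : 0 <= r%:R / v * (1 - p).
    by rewrite mulr_ge0 ?divr_ge0 ?(ltW v_gt0) ?(ltW q_gt0).
  have iE : i.+1%:R = i%:R + 1 :> R by rewrite -natr1.
  (* This is the ratio bound with denominators cleared. If [i + 1 <= m p], the left side is not
     positive; otherwise it is at most [r], and [r = (r / v) (1 - p) m p] by [rv]. *)
  have key : i.+1%:R - (m%:R + 1) * p <= r%:R / v * (1 - p) * i.+1%:R.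
    have [imp|imp] := lerP i.+1%:R (m%:R * p).
      by apply: (@le_trans _ _ 0); [lra | rewrite mulr_ge0].
    apply: (@le_trans _ _ r%:R); first lra.
    by rewrite -[leLHS]rv ler_wpM2l // ltW.
  rewrite iE in key *; lra.
have rv_ge0 : 0 <= r%:R / v by rewrite divr_ge0 // ltW.
have rv_r : r%:R * (r%:R / v) <= 1 / 2.
  by rewrite mulrA ler_pdivrMr // /v; lra.
(* Bernoulli's inequality, in place of the power [(1 - r / v) ^ j]; at [j = r] the factor is still
   at least 1/2 by [rv_r]. *)
have half j : (j <= r)%N -> (1 - j%:R * (r%:R / v)) * b k <= b (k + j)%N.
  elim: j => [|j IH] jr; first by rewrite mul0r subr0 mul1r addn0.
  rewrite addnS; apply: le_trans (step _ _); last first.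
    by rewrite -addnS natrD lerD // ler_nat.
  have [rv1|rv1] := lerP (r%:R / v) 1; last first.
    have r1 : 1 <= r%:R :> R by rewrite (ler_nat _ 1 r) (leq_ltn_trans _ jr).
    suff : r%:R / v <= 1 / 2 by lra.
    by apply: le_trans rv_r; rewrite ler_peMl.
  apply: (@le_trans _ _ ((1 - r%:R / v) * ((1 - j%:R * (r%:R / v)) * b k))).
    rewrite [leRHS]mulrA ler_wpM2r // -natr1.
    have : 0 <= j%:R * (r%:R / v) * (r%:R / v) by rewrite mulr_ge0 // mulr_ge0.
    lra.
  by rewrite ler_wpM2l ?subr_ge0 // IH // ltnW.
have half' j : (j <= r)%N -> b k / 2 <= b (k + j)%N.
  move=> jr; apply: le_trans (half _ jr).
  rewrite mulrC ler_wpM2r //.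
  have : j%:R * (r%:R / v) <= r%:R * (r%:R / v) by rewrite ler_wpM2r // ler_nat.
  lra.
have : \sum_(j < r.+1) b k / 2 <= 1.
  apply: le_trans sum_le1; apply: ler_sum => j _; by apply: half'; rewrite -ltnS.
rewrite sumr_const card_ord -mulr_natr ler_pdivlMr ?ltr0n //.
lra.
Qed.

(** The window contains at most [D + 1] integers. The point bound is required only up to [q] because
    [hits_prob_le] works only up to the mean, which is [q] in the application. *)
Lemma hits_window (R : realType) (m n : nat) (T : {set 'I_n}) (q D B : R) :
  0 <= q -> 0 <= D ->
  (forall k : nat, k%:R <= q ->
     bb_prob R (fun f : outcome m n => hits f T == k) <= B) ->
  bb_prob R (fun f : outcome m n => q - D <= (hits f T)%:R < q) <= (D + 1) * B.
Proof.
move=> q_ge0 D_ge0 leB.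
pose a := Num.truncn q; pose e := Num.truncn D.
have aq : a%:R <= q by rewrite truncn_le.
have eD : e%:R <= D by rewrite truncn_le.
have B_ge0 : 0 <= B.
  apply: le_trans (leB _ aq); apply: sumr_ge0 => f _.
  by rewrite mulr_ge0 // outcome_prob_ge0.
(* Truncated subtraction may repeat the value 0, which is harmless in a union bound. *)
apply: (@le_trans _ _ (bb_prob R (fun f : outcome m n =>
  [exists i : 'I_e.+1, hits f T == (a - i)%N]))).
  apply: le_bb_prob => f /andP[lo hi].
  have xa : (hits f T <= a)%N by rewrite truncn_ge_nat // ltW.
  have ia : (a - hits f T < e.+1)%N.
    rewrite ltnS truncn_ge_nat // natrB //; lra.
  by apply/existsP; exists (Ordinal ia); rewrite /= subKn.
apply: le_trans (bb_prob_exists _ _) _.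
apply: (@le_trans _ _ (\sum_(i < e.+1) B)).
  apply: ler_sum => i _; apply: leB; apply: le_trans aq.
  by rewrite ler_nat leq_subr.
rewrite sumr_const card_ord -mulr_natl ler_wpM2r // -natr1; lra.
Qed.

(** * Chernoff bounds *)

Lemma expR_le_quadratic (R : realType) (s : R) :
  s <= 1 / 2 -> expR s <= 1 + s + 2 * s ^+ 2.
Proof.
move=> s_le; have h := expR_ge1Dx (- s).
have s1 : 0 < 1 - s by lra.
apply: (@le_trans _ _ (1 - s)^-1).
  by rewrite -[s in expR s]opprK expRN lef_pV2 ?posrE ?expR_gt0.
rewrite -[leLHS]mul1r ler_pdivrMr //.
(* [(1 - s) (1 + s + 2 s^2) = 1 + s^2 (1 - 2 s)]. *)
have := mulr_ge0 (sqr_ge0 s) (_ : 0 <= 1 - 2 * s); nra.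
Qed.

(** Markov's inequality for the exponential of [s * hits f T], whose expectation factors over the
    balls. Positive [s] gives the upper tail and negative [s] the lower one. *)
Lemma hits_chernoff (R : realType) (m n : nat) (T : {set 'I_n}) (s t : R) :
  (0 < n)%N -> s <= 1 / 2 ->
  bb_prob R (fun f : outcome m n =>
    `|s| * t <= s * ((hits f T)%:R - m%:R * (#|T|%:R / n%:R))) <=
  expR (2 * (m%:R * (#|T|%:R / n%:R)) * s ^+ 2 - `|s| * t).
Proof.
move=> n_gt0 s_le; set p : R := #|T|%:R / n%:R.
have p_ge0 : 0 <= p by rewrite divr_ge0.
have p_le1 : p <= 1.
  by rewrite ler_pdivrMr ?ltr0n // mul1r ler_nat -[leqRHS]card_ord max_card.
have meanE := @sum_mean_indicator R n T (expR s) n_gt0; rewrite -/p in meanE; clearbody p.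
pose a := - s * (m%:R * p) - `|s| * t.
apply: (@le_trans _ _ (bb_expectation (fun f : outcome m n =>
    expR a * \prod_(b < m) (if f b \in T then expR s else 1)))).
  apply: le_bb_expectation => f.
  rewrite -big_mkcond /= prodr_const -expRM_natl.
  have -> : #|(fun b => f b \in T)| = hits f T by rewrite /hits cardsE.
  rewrite -expRD; have [h|_] /= := lerP (`|s| * t) _; last exact: expR_ge0.
  rewrite mulr1n -[leLHS]expR0 ler_expR /a; lra.
rewrite bb_expectationZ (bb_expectation_prod _ (fun j => if j \in T then expR s else 1)).
rewrite meanE.
apply: (@le_trans _ _ (expR a * expR (p * (s + 2 * s ^+ 2)) ^+ m)).
  rewrite ler_pM2l ?expR_gt0 // lerXn2r ?nnegrE ?expR_ge0 //.
    have := ler_wpM2l p_ge0 (ltW (expR_gt0 s)).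
    lra.
  apply: le_trans (expR_ge1Dx _); rewrite lerD2l ler_wpM2l //.
  have := expR_le_quadratic s_le; lra.
rewrite -expRM_natl -expRD ler_expR /a; lra.
Qed.

Lemma hits_deviation (R : realType) (m n : nat) (T : {set 'I_n}) (t : R) :
  (0 < n)%N ->
  let p : R := #|T|%:R / n%:R in
  0 < m%:R * p -> 0 <= t <= 2 * (m%:R * p) ->
  bb_prob R (fun f : outcome m n => t <= `|(hits f T)%:R - m%:R * p|) <=
  2 * expR (- (t ^+ 2 / (8 * (m%:R * p)))).
Proof.
move=> n_gt0 p mp_gt0 /andP[t_ge0 t_le].
have chernoff s : s <= 1 / 2 ->
    bb_prob R (fun f : outcome m n => `|s| * t <= s * ((hits f T)%:R - m%:R * p)) <=
    expR (2 * (m%:R * p) * s ^+ 2 - `|s| * t).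
  exact: hits_chernoff.
clearbody p.
(* This minimises the exponent [2 m p s^2 - s t]; the upper bound on [t] amounts to [s <= 1 / 2]. *)
pose s := t / (4 * (m%:R * p)).
have s_ge0 : 0 <= s by rewrite divr_ge0 // mulr_ge0 // ltW.
have s_le : s <= 1 / 2 by rewrite ler_pdivrMr 1?mulr_gt0 //; lra.
have expE : 2 * (m%:R * p) * s ^+ 2 - s * t = - (t ^+ 2 / (8 * (m%:R * p))).
  by rewrite /s; move: (m%:R * p) mp_gt0 => M M_gt0; field; rewrite lt0r_neq0.
have up := chernoff _ s_le.
have Ns_le : - s <= 1 / 2 by lra.
have down := chernoff _ Ns_le.
rewrite ger0_norm // expE in up.
rewrite normrN ger0_norm // sqrrN expE in down.
apply: (@le_trans _ _ (_ + _)); last by rewrite mulrDl mul1r; apply: lerD up down.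
apply: le_trans (bb_probU _ _ _); apply: le_bb_prob => f /= h.
set x := _ - _ in h *.
have [x_ge0|x_lt0] := lerP 0 x.
  by rewrite ger0_norm // in h; rewrite ler_wpM2l.
rewrite ltr0_norm // in h; apply/orP; right.
by rewrite mulNr -mulrN ler_wpM2l.
Qed.

(** * Orderings and the set of their first agents *)

Definition first_agents (n l : nat) (s : {perm 'I_n}) : {set 'I_n} :=
  [set j | (s j < l)%N].

Lemma card_first_agents (n l : nat) (s : {perm 'I_n}) :
  (l <= n)%N -> #|first_agents l s| = l.
Proof.
move=> ln; transitivity #|[set i : 'I_n | (i < l)%N]|.
  have -> : first_agents l s = s @^-1: [set i : 'I_n | (i < l)%N].
    by apply/setP => j; rewrite !inE.
  by rewrite card_preimset //; apply: perm_inj.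
rewrite -sum1_card; under eq_bigl do rewrite inE.
by rewrite -(big_ord_widen _ (fun=> 1%N)) // sum1_card card_ord.
Qed.

Lemma first_agents_tperm (n l : nat) (s : {perm 'I_n}) (i j : 'I_n) :
  (i < l)%N -> (j < l)%N -> first_agents l (s * tperm i j)%g = first_agents l s.
Proof.
move=> il jl; apply/setP => k; rewrite !inE permM.
by case: tpermP => [->|->|//]; rewrite il jl.
Qed.

(** Composition with [tperm i j] exchanges the agents in positions [i] and [j], a bijection between
    the two sets of orderings. *)
Lemma sum_perm_at (A : nmodType) (n : nat) (F : {perm 'I_n} -> A) (a i j : 'I_n) :
  \sum_(s : {perm 'I_n} | s a == j) F s =
  \sum_(s : {perm 'I_n} | s a == i) F (s * tperm i j)%g.
Proof.
rewrite (reindex_inj (mulIg (tperm i j))) /=; apply: eq_bigl => s.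
by rewrite permM (canF_eq (tpermK i j)) tpermR.
Qed.

Lemma card_perm_at (n : nat) (a i : 'I_n) :
  (n * #|[pred s : {perm 'I_n} | s a == i]|)%N = n`!.
Proof.
rewrite -card_Sn -[RHS]sum1_card.
rewrite [RHS](partition_big (fun s : {perm 'I_n} => s a) predT) //=.
under eq_bigr do rewrite (sum_perm_at _ a i) sum1_card.
by rewrite sum_nat_const card_ord.
Qed.

(** Exchanging two positions below [l] preserves the set of the first [l] agents, so all [l]
    positions of [a] below [l] give the same sum; the remaining positions only add nonnegative
    terms. *)
Lemma sum_first_agents_at (R : numDomainType) (n l : nat)
    (h : {set 'I_n} -> R) (a i : 'I_n) :
  (forall T, 0 <= h T) -> (l <= n)%N -> (i < l)%N ->
  l%:R * (\sum_(s : {perm 'I_n} | s a == i) h (first_agents l s)) <=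
  \sum_(s : {perm 'I_n}) h (first_agents l s).
Proof.
move=> h_ge0 ln il.
rewrite [leRHS](partition_big (fun s : {perm 'I_n} => s a) predT) //=.
apply: (@le_trans _ _ (\sum_(j < n | (j < l)%N)
    \sum_(s : {perm 'I_n} | s a == j) h (first_agents l s))).
  rewrite [leRHS](eq_bigr (fun=> \sum_(s : {perm 'I_n} | s a == i) h (first_agents l s))).
    by rewrite -(big_ord_widen _ (fun=> _)) // sumr_const card_ord mulr_natl.
  move=> j jl; rewrite (sum_perm_at _ a i j); apply: eq_bigr => s _.
  by rewrite first_agents_tperm.
rewrite [leRHS](bigID (fun j : 'I_n => (j < l)%N)) /= lerDl.
by apply: sumr_ge0 => j _; apply: sumr_ge0.
Qed.

(** * Marginal contributions in a weighted voting game *)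

Lemma voting_game_le (R : realType) (n : nat) (w : 'I_n -> R) (q : R) (S T : {set 'I_n}) :
  coalition_weight w S <= coalition_weight w T ->
  voting_game w q S <= voting_game w q T.
Proof.
rewrite /voting_game => ST; case: ifP => [qS|_]; last by case: ifP.
by rewrite (le_trans qS ST).
Qed.

Lemma coalition_weightU1 (R : realType) (n : nat) (w : 'I_n -> R) (a : 'I_n)
    (S : {set 'I_n}) :
  a \notin S -> coalition_weight w (S :|: [set a]) = w a + coalition_weight w S.
Proof. by move=> aS; rewrite /coalition_weight finset.setUC big_setU1. Qed.

Lemma predecessors_notin (n : nat) (s : {perm 'I_n}) (a : 'I_n) :
  a \notin predecessors s a.
Proof. by rewrite inE ltnn. Qed.

Lemma marginal_ge0 (R : realType) (n : nat) (w : 'I_n -> R) (q : R) (a : 'I_n)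
    (s : {perm 'I_n}) :
  0 <= w a ->
  0 <= voting_game w q (predecessors s a :|: [set a]) -
       voting_game w q (predecessors s a).
Proof.
move=> w_ge0; rewrite subr_ge0; apply: voting_game_le.
by rewrite coalition_weightU1 ?predecessors_notin // lerDr.
Qed.

(** Here [x] is the weight of the first [l] agents, among them [a] of weight [wa]. In turn: they
    reach the quota even without [a]; the next agent, known only to weigh at least [wa], may not
    lift them to the quota; they fall short by at most the spread [D]. *)
Definition off_quota (R : realType) (q wa D x : R) : bool :=
  [|| q + wa <= x, x + wa < q | q - D <= x < q].

(* Pairs the orderings with [a] in position [l - 1] or [l], counted from 0, by exchanging the
   agents in these two positions: [a] is pivotal in at least one ordering of the
   pair unless the total weight of the first [l] agents is close below the quota
   or far from it. *)
Lemma sum_marginals_ge (R : realType) (n l : nat) (w : 'I_n -> R) (q D : R)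
    (a i : 'I_n) :
  0 <= w a -> (forall j, w a <= w j <= w a + D) -> i.+1 = l -> (l < n)%N ->
  \sum_(s : {perm 'I_n} | s a == i)
     (1 - (off_quota q (w a) D (coalition_weight w (first_agents l s)))%:R) <=
  \sum_(s : {perm 'I_n})
     (voting_game w q (predecessors s a :|: [set a]) -
      voting_game w q (predecessors s a)).
Proof.
move=> wa_ge0 wD il ln; pose j := Ordinal ln.
have ij : i != j by rewrite -val_eqE /= -il neq_ltn ltnSn.
pose marg s := voting_game w q (predecessors s a :|: [set a]) -
      voting_game w q (predecessors s a).
apply: (@le_trans _ _ (\sum_(s : {perm 'I_n} | s a == i) marg s +
    \sum_(s : {perm 'I_n} | s a == j) marg s)); last first.
  rewrite [leRHS](bigID (fun s : {perm 'I_n} => s a == i)) /= lerD2l.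
  rewrite [leRHS](bigID (fun s : {perm 'I_n} => s a == j)) /=.
  rewrite [X in _ <= X + _](eq_bigl (fun s : {perm 'I_n} => s a == j)).
    by rewrite lerDl sumr_ge0 // => s _; apply: marginal_ge0.
  move=> s; case: (s a =P j) => [->|_]; last by rewrite andbF.
  by rewrite andbT eq_sym.
rewrite (sum_perm_at _ a i j) -big_split /=; apply: ler_sum => s /eqP sa.
have [_|] := boolP (off_quota _ _ _ _).
  by rewrite subrr addr_ge0 //; apply: marginal_ge0.
pose s' := (s * tperm i j)%g; pose b := (s^-1)%g j.
have sb : s b = j by rewrite permKV.
have ab : a != b by apply: contraNneq ij => ab; rewrite -sa ab sb.
pose P := predecessors s a.
have TE : P :|: [set a] = first_agents l s.
  apply/setP => k; rewrite !inE sa -il [RHS]ltnS [RHS]leq_eqVlt orbC.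
  by rewrite -sa (inj_eq (@ord_inj n)) (inj_eq perm_inj).
have P'E : predecessors s' a = P :|: [set b].
  apply/setP => k; rewrite !inE !permM sa tpermL /= -il.
  case: tpermP => [ski|skj|/eqP ski /eqP skj].
  - have -> : k = a by apply: (@perm_inj _ s); rewrite ski sa.
    by rewrite (negbTE ab) sa /j /= -il !ltnn.
  - have -> : k = b by apply: (@perm_inj _ s); rewrite skj sb.
    by rewrite eqxx orbT ltnSn.
  - rewrite [LHS]ltnS [LHS]leq_eqVlt (inj_eq (@ord_inj n)) (negbTE ski) /=.
    by rewrite -(inj_eq (@perm_inj _ s)) sb (negbTE skj) orbF.
have aP : a \notin P by apply: predecessors_notin.
have bP : b \notin P by rewrite inE sa sb -leqNgt /= -il leqnSn.
rewrite /marg -/s' P'E TE -TE /voting_game -/P.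
have aPb : a \notin P :|: [set b] by rewrite finset.in_setU finset.in_set1 negb_or aP ab.
rewrite !coalition_weightU1 // subr0.
(* From here on [x] is the weight of [P], without [a]. Agent [a] is pivotal in [s] iff
   [x < q <= w a + x], and in [s'] iff [w b + x < q <= w a + (w b + x)]. The outermost bounds
   [x < q] and [q <= w a + (w b + x)] always hold here. If [w a + x] is below [q], it is below
   [q - D], and [w b <= w a + D] yields [w b + x < q]. *)
move: (coalition_weight w P) (wD b) => x /andP[wab wbD].
rewrite /off_quota !negb_or -!ltNge -!leNgt => /and3P[xlt xge window].
have -> : (q <= x) = false by apply/negbTE; rewrite -ltNge; lra.
have -> : q <= w a + (w b + x) by lra.
have [_|xq] := lerP q (w a + x); first by case: ifP => _; lra.
rewrite xq andbT -ltNge in window.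
have -> : (q <= w b + x) = false by apply/negbTE; rewrite -ltNge; lra.
lra.
Qed.

(** * From sorted weights and bin loads to the expected Shapley value *)

Lemma bb_weight_perm (R : realType) (m n : nat) (f : outcome m n) :
  exists pi : {perm 'I_n}, forall i, bb_weight R f i = (bin_load f (pi i))%:R.
Proof.
have : perm_eq (sorted_loads f) [tuple bin_load f j | j < n] by rewrite perm_sort.
case/tuple_permP => pi E; exists pi => i.
by rewrite /bb_weight E nth_mktuple tnth_mktuple.
Qed.

Lemma bb_weight_min (R : realType) (m n : nat) (f : outcome m n) (a j : 'I_n) :
  a = 0%N :> nat -> bb_weight R f a <= bb_weight R f j.
Proof.
move=> a0; rewrite ler_nat a0.
have sz : size (sorted_loads f) = n by rewrite size_sort size_map size_enum_ord.
apply: (sorted_leq_nth leq_trans leqnn) => //; rewrite ?inE ?sz //.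
  exact: sort_sorted leq_total _.
by rewrite -a0.
Qed.

(** A coarsening of [off_quota] without the random weight [wa]: as soon as [t <= wa], its first two
    alternatives both force [x] to be at distance at least [t] from [q]. *)
Definition far_or_below (R : realType) (q t D x : R) : bool :=
  (t <= `|x - q|) || (q - D <= x < q).

(** Agent [i] owns the bin [pi i], so an ordering [s] of the agents becomes the ordering [pi^-1 * s]
    of the bins. *)
Lemma bb_weight_first_agents (R : realType) (m n l : nat) (f : outcome m n)
    (pi s : {perm 'I_n}) :
  (forall i, bb_weight R f i = (bin_load f (pi i))%:R) ->
  coalition_weight (bb_weight R f) (first_agents l s) =
  (hits f (first_agents l (pi^-1 * s)%g))%:R.
Proof.
move=> piE; rewrite /coalition_weight -sum_bin_load natr_sum.
rewrite [RHS](reindex_inj (@perm_inj _ pi)); apply: eq_big => i; last by rewrite piE.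
by rewrite !inE permM permK.
Qed.

(** The deterministic half of the argument: when all loads are within [d] of [mu], the weights
    spread over at most [2 d] and the least one is at least [mu / 2], so the pairing of orderings
    applies with a fixed exceptional event. *)
Lemma shapley_ge (R : realType) (m n l : nat) (f : outcome m n) (a : 'I_n)
    (q mu d : R) :
  a = 0%N :> nat -> (0 < l < n)%N -> d <= mu / 2 ->
  (forall j, `|(bin_load f j)%:R - mu| <= d) ->
  n%:R^-1 - (n`!%:R * l%:R)^-1 *
    \sum_(s : {perm 'I_n})
       (far_or_below q (mu / 2) (2 * d) (hits f (first_agents l s))%:R)%:R <=
  shapley (voting_game (bb_weight R f) q) a.
Proof.
move=> a0 /andP[l_gt0 ln] dmu good.
have n_gt0 : (0 < n)%N by apply: leq_ltn_trans ln.
have l1n : (l.-1 < n)%N by rewrite prednK // ltnW.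
pose i := Ordinal l1n; have il : i.+1 = l by rewrite /= prednK.
have [pi piE] := bb_weight_perm R f.
pose w := bb_weight R f.
have w_near j : mu - d <= w j <= mu + d.
  by have := good (pi j); rewrite /w piE ler_distl.
have w_ge0 j : 0 <= w j by rewrite ler0n.
have wD j : w a <= w j <= w a + 2 * d.
  rewrite bb_weight_min //=; have /andP[_ ?] := w_near j; have /andP[? _] := w_near a.
  lra.
have := sum_marginals_ge q (w_ge0 a) wD il ln.
pose h (T : {set 'I_n}) : R :=
  (far_or_below q (mu / 2) (2 * d) (hits f (pi @: T))%:R)%:R.
have piS (s : {perm 'I_n}) : pi @: first_agents l s = first_agents l (pi^-1 * s)%g.
  apply/setP => k; rewrite -[k](permKV pi) (mem_imset _ _ (@perm_inj _ pi)).
  by rewrite !inE permM permK.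
(* The permutation [pi] depends on the outcome, but over all orderings it only reindexes the sum;
   here the sorting drops out. *)
have sum_h : \sum_s h (first_agents l s) =
    \sum_s (far_or_below q (mu / 2) (2 * d) (hits f (first_agents l s))%:R)%:R.
  rewrite [RHS](reindex_inj (mulgI (pi^-1)%g)) /=.
  by apply: eq_bigr => s _; rewrite /h piS.
have := sum_first_agents_at (h := h) a (fun T => ler0n _ _) (ltnW ln) (_ : (i < l)%N).
rewrite sum_h; set F := \sum_s _; set H := \sum_(s | _) _.
rewrite -[in (i < l)%N]il => /(_ (ltnSn _)) leF leM.
have leH : \sum_(s : {perm 'I_n} | s a == i) (1 : R) - H <=
   \sum_(s : {perm 'I_n} | s a == i)
     (1 - (off_quota q (w a) (2 * d) (coalition_weight w (first_agents l s)))%:R).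
  rewrite -sumrB; apply: ler_sum => s _; rewrite lerD2l lerN2.
  rewrite /h piS /w (bb_weight_first_agents _ _ piE) ler_nat.
  move: (hits _ _)%:R => x; rewrite /off_quota /far_or_below.
  have /andP[wa_ge _] := w_near a; rewrite -/(w a).
  have [xq|xq] := lerP (mu / 2) `|x - q|; first by case: (_ || _).
  move: xq; rewrite ltr_distl => /andP[? ?].
  have -> : (q + w a <= x) = false by apply/negbTE; rewrite -ltNge; lra.
  by have -> : (x + w a < q) = false by apply/negbTE; rewrite -leNgt; lra.
have := le_trans leH leM; rewrite sumr_const => {leH leM} main.
have nf_gt0 : 0 < n`!%:R :> R by rewrite ltr0n fact_gt0.
have cardE : n`!%:R = n%:R * #|[pred s : {perm 'I_n} | s a == i]|%:R :> R.
  by rewrite -natrM card_perm_at.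
have nR_gt0 : 0 < n%:R :> R by rewrite ltr0n.
have lR_gt0 : 0 < l%:R :> R by rewrite ltr0n.
rewrite /shapley [leRHS]mulrC ler_pdivlMr //; apply: le_trans main.
rewrite mulrBl -/F.
have -> : n%:R^-1 * n`!%:R = #|[pred s : {perm 'I_n} | s a == i]|%:R :> R.
  by rewrite cardE mulKf // lt0r_neq0.
rewrite lerD2l lerN2.
have -> : (n`!%:R * l%:R)^-1 * F * n`!%:R = F / l%:R.
  by field; rewrite !lt0r_neq0.
by rewrite ler_pdivlMr // mulrC.
Qed.

Lemma shapley_ge0 (R : realType) (m n : nat) (f : outcome m n) (a : 'I_n) (q : R) :
  0 <= shapley (voting_game (bb_weight R f) q) a.
Proof.
rewrite mulr_ge0 ?invr_ge0 // sumr_ge0 // => s _.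
by apply: marginal_ge0; rewrite ler0n.
Qed.

(** On an outcome with an atypical load the Shapley value is only known to be nonnegative. This
    loses [1 / n], which cancels the factor [n] of the union bound over bins, so [e] enters with
    coefficient 1. *)
Lemma expected_shapley_ge (R : realType) (m n l : nat) (a : 'I_n)
    (q mu d e B : R) :
  a = 0%N :> nat -> (0 < l < n)%N -> d <= mu / 2 ->
  (forall j, bb_prob R (fun f : outcome m n => d <= `|(bin_load f j)%:R - mu|) <= e) ->
  (forall T : {set 'I_n}, #|T| = l ->
    bb_prob R (fun f : outcome m n =>
      far_or_below q (mu / 2) (2 * d) (hits f T)%:R) <= B) ->
  n%:R^-1 - e - l%:R^-1 * B <=
  bb_expectation (fun f : outcome m n => shapley (voting_game (bb_weight R f) q) a).
Proof.
move=> a0 lb dmu le_e leB; have /andP[l_gt0 ln] := lb.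
have n_gt0 : (0 < n)%N by apply: leq_ltn_trans ln.
have nR_gt0 : 0 < n%:R :> R by rewrite ltr0n.
pose bad (f : outcome m n) := [exists j, d <= `|(bin_load f j)%:R - mu|].
pose F (f : outcome m n) := \sum_(s : {perm 'I_n})
       (far_or_below q (mu / 2) (2 * d) (hits f (first_agents l s))%:R)%:R : R.
have F_ge0 f : 0 <= F f by apply: sumr_ge0.
have c_ge0 : 0 <= (n`!%:R * l%:R)^-1 :> R by rewrite invr_ge0 mulr_ge0.
apply: (@le_trans _ _ (bb_expectation (fun f : outcome m n =>
  n%:R^-1 + ((- n%:R^-1) * (bad f)%:R + (- (n`!%:R * l%:R)^-1) * F f)))); last first.
  apply: le_bb_expectation => f.
  have [badf|/existsPn goodf] := boolP (bad f).
    apply: le_trans (shapley_ge0 _ _ _); rewrite mulr1 addrA subrr add0r mulNr.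
    by rewrite oppr_le0 mulr_ge0.
  rewrite mulr0 add0r mulNr; apply: shapley_ge => // j.
  by rewrite ltW // ltNge.
rewrite !bb_expectationD bb_expectation_cst // !bb_expectationZ !mulNr -!addrA.
rewrite lerD2l -!opprD lerN2 lerD //.
  rewrite ler_pdivrMl //; apply: le_trans (bb_prob_exists _ _) _.
  apply: (@le_trans _ _ (\sum_(j < n) e)); first by apply: ler_sum.
  by rewrite sumr_const card_ord mulr_natl.
rewrite bb_expectation_sum invfM mulrAC mulrC ler_wpM2l ?invr_ge0 //.
rewrite mulrC ler_pdivrMr ?ltr0n ?fact_gt0 //.
apply: (@le_trans _ _ (\sum_(s : {perm 'I_n}) B)).
  by apply: ler_sum => s _; apply: leB; rewrite card_first_agents // ltnW.
by rewrite sumr_const card_Sn mulr_natr.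
Qed.

(** * Choice of the deviations and final estimates *)

Lemma bin_load_deviation (R : realType) (m n : nat) (d : R) (j : 'I_n) :
  (0 < m)%N -> 0 < ln n%:R :> R -> d ^+ 2 = 16 * (m%:R / n%:R) * ln n%:R ->
  0 <= d <= 2 * (m%:R / n%:R) ->
  bb_prob R (fun f : outcome m n => d <= `|(bin_load f j)%:R - m%:R / n%:R|) <=
  2 * n%:R^-1 ^+ 2.
Proof.
move=> m_gt0 L_gt0 dE d_le.
have n_gt0 : (0 < n)%N by apply: leq_ltn_trans (ltn_ord j).
have nR_gt0 : 0 < n%:R :> R by rewrite ltr0n.
have mu_gt0 : 0 < m%:R / n%:R :> R by rewrite divr_gt0 // ltr0n.
have := @hits_deviation R m n [set j] d n_gt0; rewrite /= cards1 mul1r.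
move=> /(_ mu_gt0 d_le) H.
apply: le_trans (le_trans _ H) _.
  by apply: le_bb_prob => f; rewrite hits_set1.
rewrite ler_pM2l // dE.
(* The constant 16 is chosen to make the exponent [2 ln n]. *)
have -> : 16 * (m%:R / n%:R) * ln n%:R / (8 * (m%:R / n%:R)) = ln n%:R * 2%:R :> R.
  by move: (m%:R / n%:R) mu_gt0 => mu mu_gt0; field; rewrite lt0r_neq0.
by rewrite expRN expRM_natr lnK ?posrE // exprVn.
Qed.

Lemma hits_prob_le_sqrt (R : realType) (m n k : nat) (T : {set 'I_n}) (g : R) :
  (0 < m)%N -> (0 < n)%N -> 0 < g -> g <= #|T|%:R / n%:R <= 1 - g ->
  k%:R <= m%:R * (#|T|%:R / n%:R) :> R ->
  bb_prob R (fun f : outcome m n => hits f T == k) <= 4 / (g * Num.sqrt m%:R).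
Proof.
move=> m_gt0 n_gt0 g_gt0 pb kmp; set p : R := #|T|%:R / n%:R in pb kmp *.
have sm_gt0 : 0 < Num.sqrt m%:R :> R by rewrite sqrtr_gt0 ltr0n.
have sm2 : Num.sqrt m%:R ^+ 2 = m%:R :> R by rewrite sqr_sqrtr.
have /andP[p_ge p_le] := pb.
(* Since [p] and [1 - p] are at least [g], this choice gives [2 r^2 <= m g^2 / 2 <= m p (1 - p)]. *)
pose x : R := g * Num.sqrt m%:R / 2; pose r := Num.truncn x.
have x_gt0 : 0 < x by rewrite divr_gt0 // mulr_gt0.
have /andP[rx xr] := truncn_itv (ltW x_gt0).
have p01 : 0 < p < 1 by apply/andP; split; lra.
apply: (@le_trans _ _ (2 / r.+1%:R)); last first.
  have -> : 4 / (g * Num.sqrt m%:R) = 2 / x.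
    by rewrite /x; field; rewrite !lt0r_neq0.
  by rewrite ler_pM2l // lef_pV2 ?posrE ?ltr0n // ltW.
apply: hits_prob_le => //.
apply: (@le_trans _ _ (2 * x ^+ 2)).
  by rewrite ler_pM2l // lerXn2r ?nnegrE // ltW.
have -> : 2 * x ^+ 2 = m%:R * (g ^+ 2 / 2) by rewrite -sm2 /x; field.
rewrite -/p -mulrA ler_wpM2l //.
clearbody p; nra.
Qed.

Lemma far_or_below_prob (R : realType) (m n l : nat) (T : {set 'I_n}) (g c D : R) :
  (0 < l < n)%N -> 0 < g -> 0 < c -> 0 <= D ->
  g <= l%:R / n%:R <= 1 - g -> c * n%:R ^+ 3 <= m%:R -> #|T| = l ->
  bb_prob R (fun f : outcome m n =>
    far_or_below (l%:R * (m%:R / n%:R)) (m%:R / n%:R / 2) D (hits f T)%:R) <=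
  64 / c / n%:R + (D + 1) * (4 / (g * Num.sqrt m%:R)).
Proof.
move=> /andP[l_gt0 ln] g_gt0 c_gt0 D_ge0 pb mc cardT.
have n_gt0 : (0 < n)%N by apply: leq_ltn_trans ln.
have nR_gt0 : 0 < n%:R :> R by rewrite ltr0n.
have lR_ge1 : 1 <= l%:R :> R by rewrite (ler_nat _ 1).
have lR_le : l%:R <= n%:R :> R by rewrite ler_nat ltnW.
have mR_gt0 : 0 < m%:R :> R by apply: lt_le_trans mc; rewrite mulr_gt0 // exprn_gt0.
have m_gt0 : (0 < m)%N by rewrite ltr0n in mR_gt0.
pose mu : R := m%:R / n%:R.
have mu_gt0 : 0 < mu by rewrite divr_gt0.
have qE : l%:R * mu = m%:R * (#|T|%:R / n%:R) by rewrite cardT /mu; ring.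
have q_gt0 : 0 < l%:R * mu by rewrite mulr_gt0 // ltr0n.
rewrite -/mu; apply: le_trans (bb_probU _ _ _) _; apply: lerD; last first.
  apply: hits_window => //; first exact: ltW.
  move=> k kq; apply: hits_prob_le_sqrt => //; first by rewrite cardT.
  by rewrite -qE.
have := @hits_deviation R m n T (mu / 2) n_gt0; rewrite /= -qE.
have t_le : 0 <= mu / 2 <= 2 * (l%:R * mu).
  have : 1 * mu <= l%:R * mu by rewrite ler_wpM2r // ltW.
  lra.
move=> /(_ q_gt0 t_le) H; apply: le_trans H _.
have lR_gt0 : 0 < l%:R :> R by rewrite ltr0n.
(* With [mu >= c n^2] and [l <= n] the exponent is at least [c n / 32], and the crude bound
   [exp (- y) <= 1 / y] suffices. *)
have -> : (mu / 2) ^+ 2 / (8 * (l%:R * mu)) = mu / (32 * l%:R).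
  by field; rewrite !lt0r_neq0.
have cn_gt0 : 0 < c * n%:R / 32 by rewrite divr_gt0 // mulr_gt0.
have -> : 64 / c / n%:R = 2 * (c * n%:R / 32)^-1 by field; rewrite !lt0r_neq0.
rewrite ler_pM2l // expRN lef_pV2 ?posrE ?expR_gt0 //.
apply: (@le_trans _ _ (1 + mu / (32 * l%:R))); last exact: expR_ge1Dx.
rewrite (@le_trans _ _ (mu / (32 * l%:R))) ?lerDr //.
rewrite ler_pdivlMr ?mulr_gt0 // /mu ler_pdivlMr //.
apply: le_trans mc.
have -> : c * n%:R / 32 * (32 * l%:R) * n%:R = c * n%:R ^+ 2 * l%:R by field.
by rewrite [n%:R ^+ 3]exprSr mulrA ler_wpM2l // mulr_ge0 // ?exprn_ge0 // ltW.
Qed.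

Theorem theorem4p3 (R : realType) (gamma c : R)
    (gamma_gt0 : 0 < gamma) (c_gt0 : 0 < c) :
  exists (K : R) (n0 : nat),
    forall (n l m : nat) (agent1 : 'I_n),
      (n0 <= n)%N ->
      (1 <= l <= n)%N ->
      gamma <= l%:R / n%:R <= 1 - gamma ->
      c * n%:R ^+ 3 <= m%:R ->
      nat_of_ord agent1 = 0%N ->
      let q : R := l%:R * (m%:R / n%:R) in
      1 / n%:R - K * Num.sqrt (ln n%:R / n%:R ^+ 3) <=
      bb_expectation (fun f : outcome m n =>
        shapley (voting_game (bb_weight R f) q) agent1).
Proof.
(* The 2 pays for atypical loads, [64 / c] for large deviations of the weight of the first [l]
   agents and [64 / gamma] for the window; the outer division comes from
   [1 / l <= 1 / (gamma n)]. *)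
exists (2 + (64 / c + 64 / gamma) / gamma).
(* These ensure [ln n >= 1] and [c n >= 64]. *)
exists (maxn (Num.truncn (expR 1 : R)).+1 (Num.truncn (64 / c)).+1).
move=> n l m a; rewrite geq_max => /andP[n_e n_c] /andP[l_gt0 _] pb mc a0; cbv zeta.
have n_gt0 : (0 < n)%N by apply: leq_ltn_trans n_e.
have nR_gt0 : 0 < n%:R :> R by rewrite ltr0n.
have lR_gt0 : 0 < l%:R :> R by rewrite ltr0n.
have mR_gt0 : 0 < m%:R :> R by apply: lt_le_trans mc; rewrite mulr_gt0 // exprn_gt0.
have m_gt0 : (0 < m)%N by rewrite ltr0n in mR_gt0.
have l_lt_n : (l < n)%N.
  have /andP[_ p_le] := pb; rewrite -(ltr_nat R) -[ltRHS]mul1r -ltr_pdivrMr //; lra.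
pose L : R := ln n%:R.
have L_ge1 : 1 <= L.
  rewrite -[1]expRK ler_ln ?posrE ?expR_gt0 //.
  by apply: ltW; apply: lt_le_trans (truncnS_gt _) _; rewrite ler_nat.
have L_le : L <= n%:R.
  have := le_ln1Dx (x := n%:R - 1 : R); rewrite addrCA subrr addr0 -/L.
  by move=> H; have := H _; lra.
have cn_ge : 64 <= c * n%:R.
  rewrite mulrC -ler_pdivrMr //; apply: ltW.
  by apply: lt_le_trans (truncnS_gt _) _; rewrite ler_nat.
(* The allowed error is [K * eps / n]; a spare factor [1 / n] is absorbed through [1 / n <= eps]. *)
pose eps : R := Num.sqrt (L / n%:R).
have eps_gt0 : 0 < eps by rewrite sqrtr_gt0 divr_gt0 //; lra.
have eps2 : eps ^+ 2 = L / n%:R by rewrite sqr_sqrtr // divr_ge0 //; lra.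
have n1_eps : n%:R^-1 <= eps.
  rewrite -ler_sqr ?nnegrE ?invr_ge0 ?(ltW eps_gt0) // eps2 expr2 ler_pM2r ?invr_gt0 //.
  by apply: le_trans L_ge1; rewrite invf_le1 // (ler_nat _ 1).
have epsE : Num.sqrt (L / n%:R ^+ 3) = eps / n%:R.
  have -> : L / n%:R ^+ 3 = L / n%:R * (n%:R^-1) ^+ 2 by field; rewrite lt0r_neq0.
  rewrite sqrtrM; last by rewrite divr_ge0 //; lra.
  by rewrite sqrtr_sqr gtr0_norm ?invr_gt0.
pose sm : R := Num.sqrt m%:R.
have sm_gt0 : 0 < sm by rewrite sqrtr_gt0.
have sm2 : sm ^+ 2 = m%:R by rewrite sqr_sqrtr // ltW.
pose d : R := 4 * sm * eps.
have d_gt0 : 0 < d by rewrite mulr_gt0 // mulr_gt0.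
have d2 : d ^+ 2 = 16 * (m%:R / n%:R) * L.
  by rewrite /d !exprMn sm2 eps2; field; rewrite lt0r_neq0.
pose mu : R := m%:R / n%:R.
have mu_ge : 64 * n%:R <= mu.
  rewrite ler_pdivlMr //; apply: le_trans mc.
  have : 64 * (n%:R * n%:R) <= c * n%:R * (n%:R * n%:R) by rewrite ler_wpM2r // mulr_ge0.
  by rewrite exprS expr2 !mulrA.
(* [d^2 = 16 mu L <= 16 mu n <= mu^2 / 4], by [mu >= 64 n]. *)
have d_le : d <= mu / 2.
  rewrite -ler_sqr ?nnegrE ?(ltW d_gt0) //; last by lra.
  rewrite d2 -/mu; nra.
(* Allows [2 d + 1] to be replaced by [4 d] in the bound on [B]. *)
have d_ge : 1 <= d.
  rewrite -ler_sqr ?nnegrE ?(ltW d_gt0) // d2 -/mu; nra.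
pose B : R := 64 / c / n%:R + (2 * d + 1) * (4 / (gamma * sm)).
apply: le_trans (expected_shapley_ge (l := l) (d := d) (mu := mu)
  (e := 2 * n%:R^-1 ^+ 2) (B := B) a0 _ d_le _ _);
  first last.
- move=> T cardT; apply: far_or_below_prob; rewrite ?l_gt0 //; lra.
- move=> j; apply: bin_load_deviation => //; rewrite -/L -/mu; lra.
- by rewrite l_gt0.
have B_le : B <= (64 / c + 64 / gamma) * eps.
  have -> : (64 / c + 64 / gamma) * eps = 64 / c * eps + (4 * d) * (4 / (gamma * sm)).
    by rewrite /d; field; rewrite !lt0r_neq0.
  apply: lerD; first by rewrite ler_wpM2l // divr_ge0 // ltW.
  by rewrite ler_wpM2r ?divr_ge0 ?mulr_ge0 ?ltW //; lra.
have li_le : l%:R^-1 <= n%:R^-1 / gamma.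
  have /andP[p_ge _] := pb; rewrite -invfM lef_pV2 ?posrE ?mulr_gt0 //.
  by rewrite mulrC -ler_pdivlMr.
have Kc_ge0 : 0 <= (64 / c + 64 / gamma) * eps.
  by rewrite mulr_ge0 ?addr_ge0 ?divr_ge0 ?ltW.
have lB : l%:R^-1 * B <= n%:R^-1 / gamma * ((64 / c + 64 / gamma) * eps).
  apply: (@le_trans _ _ (l%:R^-1 * ((64 / c + 64 / gamma) * eps))).
    by rewrite ler_wpM2l ?invr_ge0.
  by rewrite ler_wpM2r.
have nn : n%:R^-1 ^+ 2 <= n%:R^-1 * eps by rewrite expr2 ler_wpM2l ?invr_ge0.
rewrite epsE div1r -[leRHS]addrA lerD2l -opprD lerN2.
apply: (@le_trans _ _ (2 * (n%:R^-1 * eps) +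
    n%:R^-1 / gamma * ((64 / c + 64 / gamma) * eps))).
  by rewrite lerD // ler_pM2l.
rewrite le_eqVlt; apply/orP; left; apply/eqP.
by field; rewrite !lt0r_neq0.
Qed.
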